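(* Let $P$ be the oriented three-edge path with vertices $v_1,v_2,v_3,v_4$ and edges $v_1\to v_2$, $v_3\to v_2$, $v_4\to v_3$ (denoted $\rightarrow\leftarrow\leftarrow$), and let $P'$ be the oriented three-edge path with vertices $v_1,v_2,v_3,v_4$ and edges $v_2\to v_1$, $v_2\to v_3$, $v_3\to v_4$ (denoted $\leftarrow\rightarrow\rightarrow$). Then both $P$ and $P'$ are $\chi$-bounding: there is a function $f$ such that every oriented graph $G$ containing no induced subdigraph isomorphic to $P$ satisfies $\chi(G)\le f(\omega(G))$, and likewise for $P'$.
   Context: All graphs are finite and simple. A digraph (oriented graph) has no loops, no parallel edges and no pair of antiparallel edges (no directed cycle of length two). For a digraph $G$, $G^*$ is its underlying undirected graph, and $\chi(G)$, $\omega(G)$ denote the chromatic number and clique number of $G^*$. An oriented graph $H$ is $\chi$-bounding if there is a function $f$ such that $\chi(G)\le f(\omega(G))$ for every oriented graph $G$ not containing $H$ as an induced subdigraph. *)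

(* Defs.v *)
From mathcomp Require Import all_boot.
Set Implicit Arguments. Unset Strict Implicit. Unset Printing Implicit Defensive.

Definition oriented (T : finType) (e : rel T) : Prop :=
  (forall x, ~~ e x x) /\ (forall x y, e x y -> ~~ e y x).

Definition uadj (T : finType) (e : rel T) (x y : T) : bool := e x y || e y x.

Definition colorable (T : finType) (e : rel T) (k : nat) : bool :=
  [exists c : {ffun T -> 'I_k},
     [forall x, forall y, uadj e x y ==> (c x != c y)]].

(* chromatic number of G^*: least k admitting a proper k-colouring
   (#|T| colours always suffice, so the minimum over k <= #|T| is the true one) *)
Definition chi (T : finType) (e : rel T) : nat :=
  \big[minn/#|T|]_(k < #|T|.+1 | colorable e k) k.

Definition is_clique (T : finType) (e : rel T) (A : {set T}) : bool :=
  [forall x in A, forall y in A, (x != y) ==> uadj e x y].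

Definition omega (T : finType) (e : rel T) : nat :=
  \max_(A : {set T} | is_clique e A) #|A|.

Definition contains_induced (T U : finType) (e : rel T) (h : rel U) : Prop :=
  exists g : U -> T, injective g /\ forall u v, e (g u) (g v) = h u v.

Definition chi_bounding (U : finType) (h : rel U) : Prop :=
  exists f : nat -> nat,
    forall (T : finType) (e : rel T),
      oriented e -> ~ contains_induced e h -> chi e <= f (omega e).

(* P : vertices v1..v4 = 0..3, arcs v1->v2, v3->v2, v4->v3 *)
Definition P_rel : rel 'I_4 := fun i j =>
  [|| (val i == 0) && (val j == 1),
      (val i == 2) && (val j == 1)
    | (val i == 3) && (val j == 2)].

Definition P'_rel : rel 'I_4 := fun i j =>
  [|| (val i == 1) && (val j == 0),
      (val i == 1) && (val j == 2)
    | (val i == 2) && (val j == 3)].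

(* Main.v *)
(* Call the forbidden path P, and suppose that G has no induced P.

   Chvatal: if G is acyclic, greedy colouring along the acyclic order uses at
   most omega(G) colours.  So it suffices to partition V(G) into a number of
   acyclic sets bounded in terms of omega(G), by induction on omega(G).

   Grow a set A from a single vertex r by repeatedly adding an out-neighbour u
   of a member a of A.  Each new piece N[u] \ N[A] is controlled by induction,
   since cliques in N(u) extend by u, and no arc enters N[A] \ N[r]
   from outside N[A].  Hence all vertices reached from r, apart from those in
   N[r], split into pieces of bounded complexity with arcs between different
   pieces going only forwards; the pieces can share their colours.  No arc
   leaves the set of reached vertices, so the rest of the graph can reuse the
   same colours too. *)
Require Import Defs.
From mathcomp Require Import all_boot.
Set Implicit Arguments. Unset Strict Implicit. Unset Printing Implicit Defensive.

(** * Adjacency and cliques in an oriented graph without induced P *)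

Section PFree.

Variables (T : finType) (e : rel T).
Implicit Types (x y r : T) (S A Q X Y : {set T}).

(** The vertices [a], [b], [c], [d] play v1 to v4. In an oriented graph these arcs and
    non-adjacencies already force them to be distinct. *)
Definition induced_P_free : Prop := forall a b c d,
  e a b -> e c b -> e d c -> ~~ uadj e a c -> ~~ uadj e a d -> ~~ uadj e b d -> False.

Hypothesis e_oriented : oriented e.
Hypothesis e_free : induced_P_free.

Lemma uadjC x y : uadj e x y = uadj e y x. Proof. exact: orbC. Qed.

Lemma uadj_irr x : uadj e x x = false.
Proof. by rewrite /uadj orbb; apply/negbTE; apply: e_oriented.1. Qed.

Lemma is_cliqueP Q :
  reflect {in Q &, forall x y, x != y -> uadj e x y} (is_clique e Q).
Proof.
apply: (iffP forall_inP) => cQ x.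
  by move=> y xQ yQ; move/forall_inP: (cQ x xQ) => /(_ y yQ)/implyP.
by move=> xQ; apply/forall_inP => y yQ; apply/implyP; apply: cQ.
Qed.

Lemma sub_clique Q X : X \subset Q -> is_clique e Q -> is_clique e X.
Proof.
move=> /subsetP sXQ /is_cliqueP cQ; apply/is_cliqueP => x y xX yX.
by apply: cQ; apply: sXQ.
Qed.

Lemma clique_add v Q : {in Q, forall x, uadj e v x} -> is_clique e Q ->
  is_clique e (v |: Q).
Proof.
move=> vQ /is_cliqueP cQ; apply/is_cliqueP => x y.
move=> /setU1P[->|xQ] /setU1P[->|yQ]; rewrite ?eqxx // => xy.
- exact: vQ.
- by rewrite uadjC; apply: vQ.
- exact: cQ.
Qed.

(** * Partitions into acyclic sets *)

Definition cliques_le k S := forall Q, Q \subset S -> is_clique e Q -> #|Q| <= k.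

(** The acyclic sets are the classes of [c]: a single height [h] serves as topological order for all
    of them at once. *)
Definition acyc_colorable S n := exists c h : T -> nat,
  {in S, forall x, c x < n} /\
  {in S &, forall x y, e x y -> c x = c y -> h x < h y}.

Lemma acyc_colorable0 n : acyc_colorable set0 n.
Proof. by exists (fun=> 0), (fun=> 0); split=> [x|x y]; rewrite inE. Qed.

Lemma acyc_colorable1 r : acyc_colorable [set r] 1.
Proof.
exists (fun=> 0), (fun=> 0); split=> // x y /set1P-> /set1P-> err.
by move: (e_oriented.1 r); rewrite err.
Qed.

Lemma acyc_colorableS X Y n : X \subset Y -> acyc_colorable Y n -> acyc_colorable X n.
Proof.
move=> /subsetP sXY [c [h [cP hP]]]; exists c, h; split=> [x /sXY/cP //|x y].
by move=> /sXY xY /sXY; apply: hP.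
Qed.

Lemma acyc_colorableU X Y m n : acyc_colorable X m -> acyc_colorable Y n ->
  acyc_colorable (X :|: Y) (m + n).
Proof.
move=> [c [h [cP hP]]] [c' [h' [c'P h'P]]].
exists (fun x => if x \in X then c x else m + c' x).
exists (fun x => if x \in X then h x else h' x); split=> [x|x y].
  rewrite inE; case: ifP => /= [/cP lt _|_ /c'P]; first exact: ltn_addr.
  by rewrite ltn_add2l.
rewrite !inE; case: ifP => xX; case: ifP => yX //= xY yY exy.
- exact: hP.
- by move=> E; move: (cP x xX); rewrite E ltnNge leq_addr.
- by move=> E; move: (cP y yX); rewrite -E ltnNge leq_addr.
- by move/addnI; apply: h'P.
Qed.

(** Raising the heights on [X] above all those on [Y] makes every arc from [Y] to [X] climb, so
    shared classes stay acyclic. *)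
Lemma acyc_colorable_oneway X Y n :
    {in X & Y, forall x y, ~~ e x y} ->
  acyc_colorable X n -> acyc_colorable Y n -> acyc_colorable (X :|: Y) n.
Proof.
move=> noXY [c [h [cP hP]]] [c' [h' [c'P h'P]]].
pose M := \max_x h' x.
exists (fun x => if x \in Y then c' x else c x).
exists (fun x => if x \in Y then h' x else M.+1 + h x); split=> [x|x y].
  by rewrite inE orbC; case: ifP => /= [/c'P|_ /cP].
rewrite !inE; case: ifP => xY; case: ifP => yY; rewrite ?orbF ?orbT => xX yX exy.
- exact: h'P.
- by move=> _; rewrite ltn_addr // ltnS leq_bigmax.
- by move: (noXY x y xX yY); rewrite exy.
- by rewrite ltn_add2l; apply: hP.
Qed.

(** * Closed neighbourhoods, and sets grown along arcs *)

Definition cnbr x : {set T} := [set y | (y == x) || uadj e x y].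

Lemma cnbrC x y : (x \in cnbr y) = (y \in cnbr x).
Proof. by rewrite !inE eq_sym uadjC. Qed.

Lemma notin_cnbr x y : y \notin cnbr x -> ~~ uadj e x y.
Proof. by rewrite inE negb_or => /andP[]. Qed.

Definition dom A : {set T} := \bigcup_(a in A) cnbr a.

Lemma domP A x : reflect (exists2 a, a \in A & a \in cnbr x) (x \in dom A).
Proof.
by apply: (iffP bigcupP) => -[a aA]; [rewrite cnbrC|rewrite -cnbrC]; exists a.
Qed.

Lemma sub_dom A : A \subset dom A.
Proof. by apply/subsetP => a aA; apply/domP; exists a => //; rewrite inE eqxx. Qed.

Lemma domU1 u A : dom (u |: A) = cnbr u :|: dom A.
Proof. by rewrite /dom bigcup_setU big_set1. Qed.

(** Inductive so as to remember the order of insertion, which the next two inductions follow: each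
    new vertex has an in-neighbour among the older ones. *)
Inductive grown S r : {set T} -> Prop :=
| Grown1 : grown S r [set r]
| GrownU a u A : grown S r A -> a \in A -> u \in S -> e a u -> grown S r (u |: A).

(* If the neighbour [u] of [y] is the first one, and [a -> u] with [a] older,
   then [a -> u - y <- x] would be an induced copy of the forbidden path. *)
Lemma grown_no_in_arc S r A : grown S r A -> forall x y,
  x \notin dom A -> y \in dom A -> y \notin cnbr r -> ~~ e x y.
Proof.
elim=> [|a u {}A _ IH aA _ eau] x y; first by rewrite /dom big_set1 => _ ->.
rewrite domU1 !in_setU negb_or => /andP[xu xA].
have [yA _|yA] := boolP (y \in dom A); first exact: IH.
rewrite orbF => yu _; apply/negP => exy.
have uy : u \in cnbr y by rewrite cnbrC.
have ay : a \notin cnbr y by apply: contra yA => ay; apply/domP; exists a.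
have ax : a \notin cnbr x by apply: contra xA => ax; apply/domP; exists a.
have nux : ~~ uadj e x u by apply: notin_cnbr; rewrite cnbrC.
have [nay nax] := (notin_cnbr ay, notin_cnbr ax).
have : uadj e y u.
  move: uy; rewrite inE => /orP[/eqP uy|//].
  by rewrite -uy /uadj eau orbT in nay.
(* Whichever way the edge between [u] and [y] points, the path is P, read from [a] or from [x]. *)
case/orP => [eyu|euy].
- by apply: (e_free eau eyu exy); rewrite uadjC.
- exact: (e_free exy euy eau).
Qed.

(** Each insertion adds only the part of N[u] outside [dom A]; no arc goes from it to the older
    part, so both use the same [m] classes. *)
Lemma acyc_colorable_grown S r A m :
    {in S, forall u, acyc_colorable (S :&: cnbr u) m} -> grown S r A ->
  acyc_colorable (S :&: dom A :\: cnbr r) m.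
Proof.
move=> Sm gA; elim: gA (gA) => [|a u {}A gA IH aA uS eau _].
  rewrite /dom big_set1 (_ : _ :\: _ = set0) => [_|]; first exact: acyc_colorable0.
  by apply/setP=> x; rewrite !inE andbCA andNb andbF.
have sub : S :&: dom (u |: A) :\: cnbr r
    \subset (S :&: cnbr u :\: dom A) :|: (S :&: dom A :\: cnbr r).
  apply/subsetP=> x; rewrite domU1 in_setU !in_setD !in_setI in_setU.
  by case: (x \in dom A); case: (x \in S); case: (x \in cnbr u); case: (x \in cnbr r).
apply: acyc_colorableS sub _; apply: acyc_colorable_oneway (IH gA).
  move=> x y; rewrite !in_setD !in_setI => /andP[xA _] /and3P[yr _ yA].
  exact: (grown_no_in_arc gA).
exact: acyc_colorableS (subsetDl _ _) (Sm u uS).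
Qed.

Lemma grown_closed S r : r \in S -> exists A, [/\ grown S r A, r \in A, A \subset S &
  {in A & S, forall a u, e a u -> u \in A}].
Proof.
move=> rS; have: [/\ grown S r [set r], r \in [set r] & [set r] \subset S].
  by split; [left | rewrite inE | rewrite sub1set].
have [n] := ubnP #|~: [set r]|; elim: n [set r] => // n IH A leAn [gA rA AS].
have [/exists_inP[a aA /exists_inP[u /setDP[uS uA] eau]]|noau] :=
  boolP [exists a in A, exists u in S :\: A, e a u]; last first.
  exists A; split=> // a u aA uS eau; apply: contraR noau => uA.
  by apply/exists_inP; exists a => //; apply/exists_inP; exists u; rewrite // inE uA.
apply: (IH (u |: A)).
  by rewrite -ltnS (leq_trans _ leAn) // ltnS proper_card // setCU setIC -setDE properD1 // inE.
by split; [apply: GrownU gA aA uS eau | rewrite inE rA orbT | rewrite subUset sub1set uS].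
Qed.

(** * Bounding the number of acyclic sets, and Chvatal's argument inside one of them *)

Fixpoint acyc_bound k := if k is k'.+1 then (acyc_bound k').+1.*2 else 0.

Lemma acyc_colorable_cliques k S : cliques_le k S -> acyc_colorable S (acyc_bound k).
Proof.
elim: k S => [|k IHk] S.
  have [-> _|[x xS] /(_ [set x])] := set_0Vmem S; first exact: acyc_colorable0.
  rewrite sub1set xS cards1 ltn0 => /(_ isT) S0; suff /S0: is_clique e [set x] by [].
  by apply/is_cliqueP=> y z /set1P-> /set1P->; rewrite eqxx.
(* For a fixed clique bound, a second induction on the size of [S] splits off a set that no arc
   leaves. *)
have [n] := ubnP #|S|; elim: n S => // n IHn S leSn Sk.
have [->|[r rS]] := set_0Vmem S; first exact: acyc_colorable0.
(* The extra class holds [u] itself. *)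
have nbrS : {in S, forall u, acyc_colorable (S :&: cnbr u) (acyc_bound k).+1}.
  move=> u uS.
  suff /IHk Nu : cliques_le k [set x in S | uadj e u x].
    rewrite -add1n; apply: acyc_colorableS (acyc_colorableU (acyc_colorable1 u) Nu).
    by apply/subsetP=> x; rewrite !inE => /andP[-> /orP[->//|->]]; rewrite orbT.
  move=> Q /subsetP sQ cQ.
  have uQ : u \notin Q by apply/negP => /sQ; rewrite inE uadj_irr andbF.
  have := Sk (u |: Q); rewrite cardsU1 uQ; apply.
    by rewrite subUset sub1set uS; apply/subsetP=> x /sQ; rewrite inE => /andP[].
  by apply: clique_add cQ => x /sQ; rewrite inE => /andP[].
have [A [gA rA AS Aout]] := grown_closed rS.
rewrite -(setID S A); apply: acyc_colorable_oneway.
- move=> a u /setIP[_ aA] /setDP[uS uA]; apply: contra uA; exact: Aout.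
(* The doubling in [acyc_bound]: one half for N[r], the other for the rest of [A]. *)
- rewrite (setIidPr AS) /= -addnn.
  apply: acyc_colorableS (acyc_colorableU (nbrS r rS) (acyc_colorable_grown nbrS gA)).
  apply/subsetP=> x xA; rewrite in_setU in_setD !in_setI.
  by rewrite (subsetP AS) // (subsetP (sub_dom A)) //= andbT orbN.
- apply: IHn => [|Q sQ]; last exact: Sk (subset_trans sQ (subsetDl _ _)).
  rewrite -ltnS (leq_trans _ leSn) // ltnS proper_card //.
  by apply/properP; split; [exact: subsetDl | exists r; rewrite // inE rA].
Qed.

(** Induction on the size of [Q], deleting two different vertices in turn. The arc from [s] into [Q]
    is carried along because it orients the edge from [s] to the highest vertex of [Q]. *)
Lemma dominating_stable_vertex (X : {set T}) (h : T -> nat) (I Q : {set T}) :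
    {in X &, forall x y, e x y -> h x < h y} ->
    {in I &, forall x y, ~~ uadj e x y} ->
    I \subset X -> Q \subset X -> is_clique e Q -> Q != set0 ->
    {in Q, forall w, exists2 s, s \in I & e s w} ->
  exists2 s, s \in I & {in Q, forall w, uadj e s w} /\ exists2 z, z \in Q & e s z.
Proof.
move=> hX stI /subsetP IX; have [n] := ubnP #|Q|; elim: n Q => // n IHn Q leQn.
move=> /subsetP QX /is_cliqueP cQ /set0Pn[w0 w0Q] IQ.
have [w wQ wmax] : exists2 w, w \in Q & {in Q, forall x, h x <= h w}.
  by case: (@arg_maxnP T w0 (mem Q) h w0Q) => w wQ wmax; exists w.
(* Otherwise the arcs from [w] to [x] to [z] would climb above the highest vertex [w]. *)
have to_w x z : x \in I -> z \in Q -> e x z -> uadj e x w -> e x w.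
  move=> xI zQ exz /orP[//|ewx].
  have := ltn_trans (hX _ _ (QX _ wQ) (IX _ xI) ewx) (hX _ _ (IX _ xI) (QX _ zQ) exz).
  by rewrite ltnNge wmax.
have IHD v x : v \in Q -> x \in Q -> x != v -> exists2 s, s \in I &
   {in Q :\ v, forall z, uadj e s z} /\ exists2 z, z \in Q :\ v & e s z.
  move=> vQ xQ xv; apply: IHn.
  - by rewrite -ltnS (leq_trans _ leQn) // ltnS proper_card // properD1.
  - by apply/subsetP=> z /setD1P[_ /QX].
  - by apply: sub_clique (subD1set _ _) _; apply/is_cliqueP.
  - by apply/set0Pn; exists x; apply/setD1P.
  - by move=> z /setD1P[_ /IQ].
have [Qw|[x /setD1P[xw xQ]]] := set_0Vmem (Q :\ w).
  have [s sI esw] := IQ w wQ; exists s => //; split; last by exists w.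
  move=> z zQ; have [->|zw] := eqVneq z w; first by rewrite /uadj esw.
  by move/setP/(_ z): Qw; rewrite !inE zw zQ.
have [s sI [sQ [z /setD1P[zw zQ] esz]]] := IHD w x wQ xQ xw.
have [sw|nsw] := boolP (uadj e s w).
  exists s => //; split; last by exists z.
  by move=> y yQ; have [->//|yw] := eqVneq y w; apply: sQ; apply/setD1P.
(* As [s] misses [w], delete instead its out-neighbour [z]. *)
have [|s' s'I [s'Q [z' /setD1P[z'z z'Q] es'z']]] := IHD z w zQ wQ; first by rewrite eq_sym.
have s'w : uadj e s' w by apply: s'Q; apply/setD1P; rewrite eq_sym.
have [s'z|ns'z] := boolP (uadj e s' z).
  exists s' => //; split; last by exists z'.
  by move=> y yQ; have [->//|yz] := eqVneq y z; apply: s'Q; apply/setD1P.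
(* The remaining case yields the induced path [s' -> w <- z <- s]. *)
have es'w := to_w _ _ s'I z'Q es'z' s'w.
have ezw : e z w.
  case/orP: (cQ z w zQ wQ zw) => // ewz.
  by have := hX _ _ (QX _ wQ) (QX _ zQ) ewz; rewrite ltnNge wmax.
by case: (e_free es'w ezw esz ns'z (stI _ _ s'I sI)); rewrite uadjC.
Qed.

End PFree.

(** * Greedy colouring of the acyclic sets *)

Lemma greedy_coloring (T : finType) (d : rel T) (h : T -> nat) :
    (forall x y, d x y -> h x < h y) ->
  exists g : T -> nat, (forall x y, d x y -> g x != g y) /\
    forall x i, i < g x -> exists2 u, d u x & g u = i.
Proof.
move=> dh.
suff [g [gP gM]] : exists g : T -> nat,
    {in [set: T] &, forall x y, d x y -> g x != g y} /\
    {in [set: T], forall x i, i < g x -> exists2 u, u \in [set: T] & d u x /\ g u = i}.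
  exists g; split=> [x y|x i]; first exact: gP.
  by move=> /(gM x (in_setT x))[u _ []]; exists u.
have [n] := ubnP #|[set: T]|; elim: n [set: T] => // n IHn X leXn.
have [->|[x0 x0X]] := set_0Vmem X; first by exists (fun=> 0); split=> x; rewrite inE.
(* A highest vertex is coloured last: it has no out-arc in [X], so only in-neighbours restrict its
   colour. *)
case: (@arg_maxnP T x0 (mem X) h x0X) => v vX vmax.
have [|g [gP gM]] := IHn (X :\ v).
  by rewrite -ltnS (leq_trans _ leXn) // ltnS proper_card // properD1.
pose free m := ~~ [exists u in X :\ v, d u v && (g u == m)].
have ex_free : exists m, free m.
  exists (\max_u g u).+1; apply/negP => /exists_inP[u _ /andP[_ /eqP]].
  by apply/eqP; rewrite neq_ltn ltnS leq_bigmax.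
case: (ex_minnP ex_free) => m freem minm.
have nod x : x \in X -> d v x = false.
  by move=> xX; apply/negP => /dh; rewrite ltnNge; case/negP; apply: vmax.
exists (fun x => if x == v then m else g x); split=> [x y xX yX dxy|x xX i] /=.
  case: (eqVneq x v) dxy => [->|xv] dxy; first by rewrite nod in dxy.
  have xXv : x \in X :\ v by apply/setD1P.
  case: (eqVneq y v) dxy => [->|yv] dxy; last by apply: gP => //; apply/setD1P.
  by apply: contra freem => gx; apply/exists_inP; exists x; rewrite // dxy.
case: eqVneq => [->|xv] lti.
  have: ~~ free i by apply/negP=> /minm; rewrite leqNgt lti.
  rewrite negbK => /exists_inP[u /setD1P[uv uX] /andP[duv /eqP gu]].
  by exists u => //; rewrite (negbTE uv).
have [|u /setD1P[uv uX] gu] := gM x _ i lti; first exact/setD1P.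
by exists u => //; rewrite (negbTE uv).
Qed.

Lemma colorable_P_free (T : finType) (e : rel T) k :
    oriented e -> induced_P_free e -> cliques_le e k [set: T] ->
  colorable e (acyc_bound k * k).
Proof.
move=> e_or e_free ek.
have [c [h [cP hP]]] := acyc_colorable_cliques e_or e_free ek.
(* Keeping only arcs inside classes lets one greedy colouring treat all acyclic sets at once. *)
pose d x y := e x y && (c x == c y).
have [|g [gP gM]] := @greedy_coloring T d h.
  by move=> x y /andP[exy /eqP]; apply: hP.
have g_lt x : g x < k.
  (* A clique grows from [x] down the greedy colours: each member has an in-neighbour in the next
     lower, stable colour [j], so some vertex of colour [j] is adjacent to all of them. At colour 0
     it has [g x + 1] vertices. *)
  suff /(_ (g x) (leqnn _))[Q [cQ <- _]] : forall i, i <= g x -> exists Q : {set T},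
      [/\ is_clique e Q, #|Q| = i.+1 & {in Q, forall y, c y = c x /\ g x - i <= g y}].
    exact: ek.
  elim=> [_|i IH /[dup] lti /ltnW/IH].
    exists [set x]; split; first 1 last.
    - by rewrite cards1.
    - by move=> y /set1P->; rewrite subn0.
    - by apply/is_cliqueP => y z /set1P-> /set1P->; rewrite eqxx.
  case=> Q [cQ cardQ Qx].
  pose j := g x - i.+1.
  have ltj y : y \in Q -> j < g y.
    by case/Qx=> _; apply: leq_trans; rewrite /j subnSK.
  have [] := @dominating_stable_vertex T e e_free [set y | c y == c x] h
    [set y | (c y == c x) && (g y == j)] Q.
  - by move=> y z; rewrite !inE => /eqP cy /eqP cz /hP; apply; rewrite ?inE ?cy.
  - move=> y z; rewrite !inE => /andP[/eqP cy /eqP gy] /andP[/eqP cz /eqP gz].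
    by apply/negP => /orP[] eyz; [have := gP y z | have := gP z y];
      rewrite /d eyz cy cz gy gz !eqxx => /(_ isT).
  - by apply/subsetP=> y; rewrite !inE => /andP[].
  - by apply/subsetP=> y /Qx[cy _]; rewrite inE cy.
  - exact: cQ.
  - by rewrite -card_gt0 cardQ.
  - move=> w wQ; have [u /andP[euw /eqP cu] gu] := gM w j (ltj w wQ).
    by exists u; rewrite // inE cu (Qx w wQ).1 gu !eqxx.
  move=> s; rewrite inE => /andP[/eqP cs /eqP gs] [sQ _].
  exists (s |: Q); split; first exact: clique_add.
    rewrite cardsU1 cardQ (_ : s \notin Q) //.
    by apply/negP => /ltj; rewrite gs ltnn.
  move=> y /setU1P[->|yQ]; first by rewrite cs gs.
  by split; [exact: (Qx y yQ).1 | exact: ltnW (ltj y yQ)].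
(* The pair of class and greedy colour is coded in base [k]. *)
have lt_code x : c x * k + g x < acyc_bound k * k.
  apply: (@leq_trans ((c x).+1 * k)); first by rewrite mulSn addnC ltn_add2r.
  by rewrite leq_mul2r cP ?orbT.
apply/existsP; exists [ffun x => Ordinal (lt_code x)].
have neq x y : e x y -> c x * k + g x != c y * k + g y.
  move=> exy; apply/negP => /eqP E.
  have k_gt0 : 0 < k by apply: leq_ltn_trans (g_lt x).
  have Ec : c x = c y.
    by move: (congr1 (divn^~ k) E); rewrite !divnMDl // !divn_small ?addn0.
  have := gP x y; rewrite /d exy Ec eqxx => /(_ isT).
  by move: E; rewrite Ec => /addnI->; rewrite eqxx.
apply/forallP => x; apply/forallP => y; apply/implyP; rewrite !ffunE -val_eqE /=.
by case/orP=> /neq //; rewrite eq_sym.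
Qed.

(** * From colourings to [chi], and from P to its reverse *)

Lemma chi_le_colorable (T : finType) (e : rel T) n : colorable e n -> chi e <= n.
Proof.
move=> en; rewrite /chi.
have [leTn|ltnT] := leqP #|T| n.
  (* The default value [#|T|] of the minimum bounds [chi] here. *)
  by apply: leq_trans leTn; elim/big_rec: _ => // i m _; rewrite geq_min orbC => ->.
have: Ordinal (ltnW ltnT : n < #|T|.+1) \in index_enum 'I_#|T|.+1 by rewrite mem_index_enum.
set i0 := Ordinal _; elim: index_enum => // i s IH.
rewrite inE big_cons => /predU1P[<-|/IH le]; first by rewrite en geq_minl.
by case: ifP => // _; rewrite geq_min le orbT.
Qed.

Lemma induced_P_freeP (T : finType) (e : rel T) :
  oriented e -> ~ contains_induced e P_rel -> induced_P_free e.
Proof.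
move=> [irr asym] noP a b c d eab ecb edc nac nad nbd; apply: noP.
pose g (i : 'I_4) := nth a [:: a; b; c; d] i.
have adj x y : ~~ uadj e x y -> (e x y = false) * (e y x = false).
  by rewrite negb_or => /andP[/negbTE -> /negbTE ->].
have gP u v : e (g u) (g v) = P_rel u v.
  have [[Ea Eb] Ec] := (adj _ _ nac, adj _ _ nad, adj _ _ nbd).
  have [[eba ebc] ecd] := (asym _ _ eab, asym _ _ ecb, asym _ _ edc).
  case: u v => [[|[|[|[|//]]]] ?] [[|[|[|[|//]]]] ?];
    rewrite /g /P_rel /= ?(negbTE (irr _)) ?Ea ?Eb ?Ec ?eab ?ecb ?edc //;
    by apply: negbTE.
exists g; split=> // u v Eg.
(* Distinct vertices of the path have distinct neighbourhoods. *)
have rows w : P_rel u w = P_rel v w by rewrite -!gP Eg.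
have cols w : P_rel w u = P_rel w v by rewrite -!gP Eg.
(* Having an arc to v2, to v3 or from v4 tells the four vertices apart. *)
apply: val_inj; move: (rows (inord 1)) (rows (inord 2)) (cols (inord 3)).
rewrite /P_rel /= !inordK //.
by case: u v {Eg rows cols} => [[|[|[|[|//]]]] ?] [[|[|[|[|//]]]] ?].
Qed.

Lemma chi_bounding_P : chi_bounding P_rel.
Proof.
exists (fun k => acyc_bound k * k) => T e e_or noP; apply: chi_le_colorable.
apply: colorable_P_free => //; first exact: induced_P_freeP.
by move=> Q _ cQ; apply: (bigmax_sup Q).
Qed.

(** Reversing all arcs of the host graph keeps its underlying graph, hence [chi] and [omega]. This
    carries the result from P to P'. *)
Lemma chi_bounding_reverse (U : finType) (h h' : rel U) :
  (forall u v, h' u v = h v u) -> chi_bounding h -> chi_bounding h'.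
Proof.
move=> hh' [f fP]; exists f => T e [irr asym] noh.
pose e' : rel T := fun x y => e y x.
have adjE x y : uadj e x y = uadj e' x y by rewrite /uadj orbC.
have -> : chi e = chi e'.
  apply: eq_bigl => k; apply: eq_existsb => c.
  by apply: eq_forallb => x; apply: eq_forallb => y; rewrite adjE.
have -> : omega e = omega e'.
  apply: eq_bigl => A; apply: eq_forallb_in => x _.
  by apply: eq_forallb_in => y _; rewrite adjE.
apply: fP => [|[g [g_inj gP]]].
  by split=> // x y; apply: asym.
by apply: noh; exists g; split=> // u v; rewrite hh' -gP.
Qed.

Theorem theorem1p1 : chi_bounding P_rel /\ chi_bounding P'_rel.
Proof.
split; first exact: chi_bounding_P.
apply: chi_bounding_reverse chi_bounding_P => u v.
by rewrite /P_rel /P'_rel; congr [|| _, _ | _]; rewrite andbC.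
Qed.
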